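(* Let $\Pi$ be a (ground, non-disjunctive) program, $X=\mathit{atoms}(\Pi)$, and let $\mathit{FS}_\Pi$ be the abstract solver graph whose edges are given by $\mathit{CoreOracle}$ and the rules $\mathit{Fail}^1_{pre}$, $\mathit{Fail}^2_{pre}$, $\mathit{Find}_{pre}$, $\mathit{Main}$, $\mathit{Continue}$, $\mathit{NewSet}$, $\mathit{Final}$ (defined in the context), with initial state $\emptyset_{X,\emptyset,\mathit{core}_{\overline{X}}}$. Then: (i) every terminal state (state without outgoing edges) reachable from the initial state is of the form $\mathit{Cont}(O,U)$ or $\mathit{Ok}(O)$ for some sets of atoms $O,U$; (ii) if a state $\mathit{Ok}(O)$ is reachable in $\mathit{FS}_\Pi$, then $\mathit{FS}_\Pi$ solves cautious reasoning; (iii) if a state $\mathit{Cont}(O,U)$ is reachable in $\mathit{FS}_\Pi$, then $U\subseteq\mathit{cautious}(\Pi)\subseteq O$.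
   Context: Literals and programs. Fix a finite propositional signature. An atom $a$ is a positive literal; $\neg a$ a negative literal. For a literal $l$, $\bar l=\neg a$ if $l=a$ and $\bar l=a$ if $l=\neg a$. For a set of atoms $X$, $\mathit{lit}(X)$ is the set of literals over atoms of $X$. For a set of literals $M$: $M^+$ is the set of its positive literals, $\overline{M}=\{\bar l\mid l\in M\}$, and $M$ is consistent if it contains no literal together with its negation; a consistent $M$ is identified with the assignment mapping $a$ to true iff $a\in M$, false iff $\neg a\in M$. A rule is a pair $(A,B)$ written $A\leftarrow B$, with $B$ a finite set of literals and $A$ an atom or empty; ''$\leftarrow l$'' denotes the rule $(\emptyset,\{l\})$. A program is a finite set of rules; $\mathit{atoms}(\Pi)$ its atoms. A classical model of $\Pi$ is an assignment $M$ to $\mathit{atoms}(\Pi)$ with $A\cap M\neq\emptyset$ or $B\not\subseteq M$ for each rule $(A,B)\in\Pi$. The reduct $\Pi^X$ deletes each rule $A\leftarrow B^+,B^-$ ($B^+$/$B^-$ the positive/negative literals of $B$) with $X\cap\mathit{atoms}(B^-)\neq\emptyset$ and replaces the others by $A\leftarrow B^+$. An answer set of $\Pi$ is an assignment $M$ to $\mathit{atoms}(\Pi)$ such that $M^+$ is inclusion-minimal among the $M_0^+$ with $M_0$ a classical model of $\Pi^{M^+}$; $\Pi$ is incoherent if it has no answer set. $\mathit{cautious}(\Pi)=\bigcap_{M\text{ answer set of }\Pi}M^+$. A set $C\subseteq\mathit{lit}(\mathit{atoms}(\Pi))$ is a core of $\Pi$ if $\Pi\cup\{\leftarrow\bar l\mid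 l\in C\}$ is incoherent. States. A record is a string of literals of $\mathit{lit}(X)$ without repetitions, viewed also as a set. For a record $L$, $\widehat{L}=\{\neg a\mid\{a,\neg a\}\subseteq L\}$. States include core states $L_{O,U,\mathit{core}_N}$ ($L$ a record, $O,U\subseteq X$, $N\subseteq\mathit{lit}(X)$), control states $\mathit{Cont}(O,U)$, $\mathit{Pre}_N(O,U)$, $\mathit{Eval}(O,U)$, and terminal states $\mathit{Ok}(W)$ ($W\subseteq X$). Define $\Pi_{O,U,\mathit{core}_N}=\Pi\cup\{\leftarrow\bar l\mid l\in N\}$. Transition rules ($S\Rightarrow S'$ if condition): - $\mathit{CoreOracle}$: $\emptyset_{O,U,\mathit{core}_N}\Rightarrow L'_{O,U,\mathit{core}_N}$, where, if $\Pi_{O,U,\mathit{core}_N}$ is incoherent, $L'$ is an inconsistent record such that $\widehat{L'}$ is a core of $\Pi$ and $\widehat{L'}\subseteq N$; otherwise $L'$ is a record that is an answer set of $\Pi_{O,U,\mathit{core}_N}$. - $\mathit{Fail}^1_{pre}$: $L_{O,U,\mathit{core}_N}\Rightarrow\mathit{Pre}_{N\setminus\{l\}}(O,U\cup\{\bar l\})$ if $L$ is inconsistent and $\widehat{L}\cap N=\{l\}$. - $\mathit{Fail}^2_{pre}$: $L_{O,U,\mathit{core}_N}\Rightarrow\mathit{Pre}_{N\setminus\widehat{L}}(O,U)$ if $L$ is inconsistent and $|\widehat{L}\cap N|>1$. - $\mathit{Find}_{pre}$: $L_{O,U,\mathit{core}_N}\Rightarrow\mathit{Eval}(O\cap L,U)$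 if $L$ is consistent and $L\neq\emptyset$. - $\mathit{Main}$: $\mathit{Pre}_N(O,U)\Rightarrow\mathit{Cont}(O,U)$ if $N=\emptyset$. - $\mathit{Continue}$: $\mathit{Pre}_N(O,U)\Rightarrow\emptyset_{O,U,\mathit{core}_N}$ if $N\neq\emptyset$. - $\mathit{NewSet}$: $\mathit{Eval}(O,U)\Rightarrow\emptyset_{O,U,\mathit{core}_{\overline{O}}}$ if $O\neq U$. - $\mathit{Final}$: $\mathit{Eval}(O,U)\Rightarrow\mathit{Ok}(O)$ if $O=U$. The graph has all these states as vertices and an edge $(S,S')$ iff one of the rules allows $S\Rightarrow S'$; reachable means reachable from the initial state. The graph solves cautious reasoning if it is finite, no reachable state is reachable from itself, and the unique reachable terminal state is $\mathit{Ok}(\mathit{cautious}(\Pi))$.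
   Formalization: Part (i) excludes the program whose only rule has empty head and body (its initial state is stuck); in ''solves cautious reasoning'', uniqueness is claimed among reachable states Ok(W) only, since a state Cont(O,U) may be reachable as well, e.g. for {a <- ; b <- b}. *)

(* Defs.v *)
From Stdlib Require List.
From Stdlib Require Export Relation_Operators.
From mathcomp Require Import all_boot.

Set Implicit Arguments.
Unset Strict Implicit.
Unset Printing Implicit Defensive.

(* (a, true) is the literal a, (a, false) is the literal not a. *)
Notation literal At := (At * bool)%type.

(* The pair (A, B) is the rule A <- B; None is the empty head. *)
Notation rule At := (option At * {set literal At})%type.

Notation program At := {set rule At}.

Section Programs.

Variable At : finType.

Local Notation literal := (literal At).
Local Notation rule := (rule At).
Local Notation program := (program At).

Definition pos (a : At) : literal := (a, true).
Definition neg (a : At) : literal := (a, false).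
Definition compl (l : literal) : literal := (l.1, ~~ l.2).

Definition lits (X : {set At}) : {set literal} := [set l | l.1 \in X].
Definition pos_part (M : {set literal}) : {set At} := [set a | pos a \in M].
Definition consistent (M : {set literal}) : bool :=
  [forall l in M, compl l \notin M].

Definition constraint (l : literal) : rule := (None, [set l]).

Definition atoms (P : program) : {set At} :=
  [set a | [exists r in P, (r.1 == Some a) || [exists l in r.2, l.1 == a]]].

Definition assignment (X : {set At}) (M : {set literal}) : bool :=
  [&& M \subset lits X, consistent M
    & [forall a in X, (pos a \in M) || (neg a \in M)]].

Definition satisfies (M : {set literal}) (r : rule) : bool :=
  [exists a, (r.1 == Some a) && (pos a \in M)] || ~~ (r.2 \subset M).

Definition classical_model (P : program) (M : {set literal}) : bool :=
  assignment (atoms P) M && [forall r in P, satisfies M r].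

Definition body_pos (B : {set literal}) : {set literal} := [set l in B | l.2].

Definition reduct (P : program) (X : {set At}) : program :=
  [set ((r.1, body_pos r.2) : rule)
    | r in P & ~~ [exists a in X, neg a \in r.2]].

Definition answer_set (P : program) (M : {set literal}) : bool :=
  assignment (atoms P) M &&
  minset (fun Y => [exists M0, classical_model (reduct P (pos_part M)) M0
                               && (pos_part M0 == Y)])
         (pos_part M).

Definition incoherent (P : program) : bool := ~~ [exists M, answer_set P M].

(* The intersection is taken inside atoms(P), so that cautious(P) = atoms(P)
   when P is incoherent. *)
Definition cautious (P : program) : {set At} :=
  atoms P :&: \bigcap_(M | answer_set P M) pos_part M.

(* The program Pi_{O,U,core_N}; it does not depend on O and U. *)
Definition core_program (P : program) (N : {set literal}) : program :=
  P :|: [set constraint (compl l) | l in N].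

Definition is_core (P : program) (C : {set literal}) : bool :=
  (C \subset lits (atoms P)) && incoherent (core_program P C).

Definition record_set (L : seq literal) : {set literal} := [set l in L].

Definition is_record (X : {set At}) (L : seq literal) : bool :=
  uniq L && (record_set L \subset lits X).

Definition hat (L : seq literal) : {set literal} :=
  [set neg a | a : At & (pos a \in L) && (neg a \in L)].

Definition neg_set (O : {set At}) : {set literal} := [set neg a | a in O].

Inductive state : Type :=
| CoreSt of seq literal & {set At} & {set At} & {set literal}
| Cont of {set At} & {set At}
| Pre of {set literal} & {set At} & {set At}
| Eval of {set At} & {set At}
| Ok of {set At}.

Definition vertex (P : program) (S : state) : Prop :=
  let X := atoms P in
  match S with
  | CoreSt L O' U' N =>
      [/\ is_record X L, O' \subset X, U' \subset X & N \subset lits X]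
  | Cont O' U' => O' \subset X /\ U' \subset X
  | Pre N O' U' => [/\ N \subset lits X, O' \subset X & U' \subset X]
  | Eval O' U' => O' \subset X /\ U' \subset X
  | Ok W => W \subset X
  end.

Definition oracle_answer (P : program) (N : {set literal}) (L : seq literal)
  : bool :=
  is_record (atoms P) L &&
  (if incoherent (core_program P N)
   then [&& ~~ consistent (record_set L), is_core P (hat L) & hat L \subset N]
   else answer_set (core_program P N) (record_set L)).

Inductive step (P : program) : state -> state -> Prop :=
| CoreOracle L' O U N :
    oracle_answer P N L' ->
    step P (CoreSt [::] O U N) (CoreSt L' O U N)
(* Members of hat L are negative literals, so l = neg a and its complement is
   the atom a. *)
| Fail1_pre L O U N a :
    ~~ consistent (record_set L) -> hat L :&: N = [set neg a] ->
    step P (CoreSt L O U N) (Pre (N :\ neg a) O (a |: U))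
| Fail2_pre L O U N :
    ~~ consistent (record_set L) -> 1 < #|hat L :&: N| ->
    step P (CoreSt L O U N) (Pre (N :\: hat L) O U)
| Find_pre L O U N :
    consistent (record_set L) -> L <> [::] ->
    step P (CoreSt L O U N) (Eval (O :&: pos_part (record_set L)) U)
| Main N O U :
    N = set0 -> step P (Pre N O U) (Cont O U)
| Continue N O U :
    N <> set0 -> step P (Pre N O U) (CoreSt [::] O U N)
| NewSet O U :
    O <> U -> step P (Eval O U) (CoreSt [::] O U (neg_set O))
| Final O U :
    O = U -> step P (Eval O U) (Ok O).

Definition edge (P : program) (S S' : state) : Prop :=
  [/\ vertex P S, vertex P S' & step P S S'].

Definition init (P : program) : state :=
  CoreSt [::] (atoms P) set0 (neg_set (atoms P)).

Definition reachable (P : program) (S : state) : Prop :=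
  clos_refl_trans state (edge P) (init P) S.

Definition no_outgoing (P : program) (S : state) : Prop :=
  forall S', ~ edge P S S'.

Definition finite_graph (P : program) : Prop :=
  exists s : seq state, forall S, vertex P S -> List.In S s.

Definition acyclic (P : program) : Prop :=
  forall S, reachable P S -> ~ clos_trans state (edge P) S S.

(* The terminal states are here the states of the form Ok(W), not all states
   without outgoing edges: a control state Cont(O,U), which has none either, may
   be reachable together with Ok(cautious(P)), by other answers of the oracle.
   For P = {a <- ; b <- b}, the oracle answers [a; not a] and [a; not b] lead to
   Ok({a}), while the answer [a; not a; b; not b] leads to Cont({a,b}, {}). *)
Definition solves_cautious (P : program) : Prop :=
  [/\ finite_graph P, acyclic P
    & reachable P (Ok (cautious P)) /\
      forall W, reachable P (Ok W) -> Ok W = Ok (cautious P)].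

(* The program whose only rule has empty head and empty body. It is incoherent
   and has no atoms, hence no inconsistent record: CoreOracle does not apply and
   the initial state has no outgoing edge. *)
Definition false_program : program := [set ((None, set0) : rule)].

End Programs.

(* Main.v *)
(* Adding the constraints <- a, for neg a in N, keeps exactly the answer sets in
   which these atoms are false. Hence U <= cautious(P) <= O is invariant: a core
   {neg a} means that a holds in every answer set, and an answer set found by the
   oracle bounds cautious(P) from above. If P has an atom, N is nonempty in every
   reachable core state, so each oracle call either removes an element of N or
   finds an answer set that falsifies some atom of O; this gives termination.
   If P has no atom, no state other than the initial one is reachable. *)
From Stdlib Require List Operators_Properties.
Require Import Defs.
From mathcomp Require Import all_boot.
From mathcomp Require Import zify.

Set Implicit Arguments.
Unset Strict Implicit.
Unset Printing Implicit Defensive.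

Section CoreBasedSolver.

Variable At : finType.
Implicit Types (P Q : program At) (M N : {set literal At}) (O U Y : {set At}).

(** * Positive programs and their models as sets of atoms *)

Definition positive Q := forall r l, r \in Q -> l \in r.2 -> l.2.

(** A model of a positive program is represented here by its set of true atoms, so that the
    minimality required of answer sets is directly inclusion among such sets. *)
Definition pos_model Q Y : bool :=
  (Y \subset atoms Q) && [forall r in Q, satisfies [set pos a | a in Y] r].

Lemma in_pos_image a b Y : ((a, b) \in [set pos a | a in Y]) = b && (a \in Y).
Proof.
apply/imsetP/andP => [[c cY [-> ->]]|[-> aY]]; first by [].
by exists a.
Qed.

Lemma in_neg_set a b O : ((a, b) \in neg_set O) = ~~ b && (a \in O).
Proof.
apply/imsetP/andP => [[c cO [-> ->]]|[]]; first by [].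
by case: b => // _ aO; exists a.
Qed.

Lemma mem_atomsP P a :
  reflect (exists2 r, r \in P & r.1 = Some a \/ exists2 l, l \in r.2 & l.1 = a)
          (a \in atoms P).
Proof.
rewrite inE; apply: (iffP existsP) => [[r /andP[rP /orP[/eqP h|]]]|[r rP h]].
- by exists r => //; left.
- by case/existsP=> l /andP[lr /eqP e]; exists r => //; right; exists l.
exists r; rewrite rP /=; apply/orP; case: h => [->|[l lr e]]; first by left.
by right; apply/existsP; exists l; rewrite lr e eqxx.
Qed.

Lemma positive_reduct P Y : positive (reduct P Y).
Proof. by move=> r l /imsetP[r0 _ ->] /=; rewrite inE => /andP[]. Qed.

Lemma satisfies_pos_part Q M r : positive Q -> r \in Q ->
  satisfies M r = satisfies [set pos a | a in pos_part M] r.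
Proof.
move=> posQ rQ; rewrite /satisfies; congr (_ || ~~ _).
  by apply: eq_existsb => a; rewrite in_pos_image inE.
apply/subsetP/subsetP => sub [a b] lr; have /= bT := posQ _ _ rQ lr.
  by rewrite in_pos_image bT inE; have := sub _ lr; rewrite bT.
by have := sub _ lr; rewrite in_pos_image inE bT.
Qed.

Lemma pos_modelE Q Y : positive Q ->
  [exists M, classical_model Q M && (pos_part M == Y)] = pos_model Q Y.
Proof.
move=> posQ; apply/existsP/andP => [[M]|[YX /forallP sat]].
  case/andP=> /andP[/and3P[ML _ _] /forallP sat] /eqP <-.
  split; first by apply/subsetP => a; rewrite inE => /(subsetP ML); rewrite inE.
  apply/forallP => r; apply/implyP => rQ.
  by rewrite -(satisfies_pos_part _ posQ) //; exact: (implyP (sat r)).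
(* The witness makes the atoms of [Y] true and all other atoms of [Q] false. *)
exists [set l in lits (atoms Q) | l.2 == (l.1 \in Y)].
set M := [set l in _ | _].
have inM a b : ((a, b) \in M) = (a \in atoms Q) && (b == (a \in Y)).
  by rewrite in_set in_set.
have MY : pos_part M = Y.
  apply/setP => a; rewrite in_set inM.
  by case aY: (a \in Y); rewrite ?andbF // (subsetP YX _ aY).
rewrite MY eqxx andbT; apply/andP; split.
  apply/and3P; split.
  - by apply/subsetP => l; rewrite in_set => /andP[].
  - apply/forallP => -[a b]; apply/implyP; rewrite !inM => /andP[-> /eqP <-].
    by case: b.
  - apply/forallP => a; apply/implyP => aX; rewrite !inM aX.
    by case: (a \in Y).
apply/forallP => r; apply/implyP => rQ.
by rewrite (satisfies_pos_part _ posQ) // MY; exact: (implyP (sat r)).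
Qed.

Lemma answer_setE P M :
  answer_set P M =
  assignment (atoms P) M &&
  minset (pos_model (reduct P (pos_part M))) (pos_part M).
Proof.
congr (_ && _); rewrite /answer_set.
by apply/minset_eq => Y; apply: pos_modelE; exact: positive_reduct.
Qed.

(** Minimality compares a set only with its subsets, and these inherit [d]. It is applied with [d]
    saying that the atoms negated in [N] are absent. *)
Lemma minset_downclosed (p d : pred {set At}) Y :
  (forall Y1 Y2, Y1 \subset Y2 -> d Y2 -> d Y1) ->
  minset (fun Y0 => p Y0 && d Y0) Y = minset p Y && d Y.
Proof.
move=> dd; apply/minsetP/andP => [[/andP[pY dY] m]|[/minsetP[pY m] dY]].
  split=> //; apply/minsetP; split=> // B pB BY; apply: m => //.
  by rewrite pB (dd _ _ BY).
by split=> [|B /andP[pB _] BY]; rewrite ?pY ?dY //; apply: m.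
Qed.

(** * Adding constraints for a set of negative literals *)

Lemma neg_litE N X (l : literal At) : N \subset neg_set X -> l \in N ->
  exists2 a, l = neg a & a \in X.
Proof. by move=> NX /(subsetP NX)/imsetP[a aX ->]; exists a. Qed.

Lemma core_programP P N r :
  reflect (r \in P \/ exists2 l, l \in N & r = constraint (compl l))
          (r \in core_program P N).
Proof.
rewrite inE; apply: (iffP orP) => -[h|h]; [by left| |by left|].
  by right; case/imsetP: h => l lN ->; exists l.
by right; case: h => l lN ->; apply/imsetP; exists l.
Qed.

Lemma atoms_core P N a :
  (a \in atoms (core_program P N)) =
  (a \in atoms P) || [exists l in N, l.1 == a].
Proof.
apply/mem_atomsP/orP => [[r /core_programP[rP h|[l lN ->]]]
  |[/mem_atomsP[r rP h]|]].
- by left; apply/mem_atomsP; exists r.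
- case=> //= -[l' /set1P-> e]; right; apply/existsP; exists l.
  by rewrite lN -e eqxx.
- by exists r => //; apply/core_programP; left.
- case/existsP=> l /andP[lN /eqP e].
  exists (constraint (compl l)); first by apply/core_programP; right; exists l.
  by right; exists (compl l) => //; rewrite inE.
Qed.

Lemma atoms_core_sub P N : N \subset neg_set (atoms P) ->
  atoms (core_program P N) = atoms P.
Proof.
move=> NX; apply/setP => a; rewrite atoms_core.
case aP: (a \in atoms P) => //=; apply/negbTE/negP.
case/existsP=> l /andP[lN /eqP e].
by case: (neg_litE NX lN) => b lb; rewrite lb /= in e; rewrite e aP.
Qed.

(** The constraint added for [neg a] has the atom [a] as its whole body, so the reduct neither
    deletes nor changes it. *)
Lemma reduct_core P N X Y : N \subset neg_set X ->
  reduct (core_program P N) Y = core_program (reduct P Y) N.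
Proof.
move=> NX.
have cE (l : literal At) : l \in N ->
    body_pos (constraint (compl l)).2 = (constraint (compl l)).2.
  case/(neg_litE NX) => a -> _; apply/setP => k; rewrite !inE.
  by case: eqP => // ->.
apply/setP => r; apply/imsetP/core_programP => [[r0]|[/imsetP[r0]|[l lN ->]]].
- rewrite inE => /andP[/core_programP[r0P h ->|[l lN -> h ->]]].
    by left; apply/imsetP; exists r0 => //; rewrite inE r0P.
  by right; exists l => //; rewrite cE.
- rewrite inE => /andP[r0P h] ->; exists r0 => //; rewrite inE h andbT.
  by apply/core_programP; left.
- exists (constraint (compl l)); last by rewrite cE.
  rewrite inE; apply/andP; split; first by apply/core_programP; right; exists l.
  case: (neg_litE NX lN) => b -> _.
  by apply/existsP => -[a /andP[_]]; rewrite inE => /eqP.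
Qed.

(* The constraints of N may add atoms to Q when Q is a reduct, but they force
   these atoms to be false. *)
Lemma pos_model_core Q N X Y : N \subset neg_set X ->
  pos_model (core_program Q N) Y =
  pos_model Q Y && [forall a in Y, neg a \notin N].
Proof.
move=> NX; apply/andP/andP => [[sub /forallP sat]
  |[/andP[sub /forallP sat] /forallP dis]].
  have dis a : a \in Y -> neg a \notin N.
    move=> aY; apply/negP => aN.
    have cP : constraint (compl (neg a)) \in core_program Q N.
      by apply/core_programP; right; exists (neg a).
    have := implyP (sat _) cP => /orP[/existsP[b]//|/negP[]].
    by rewrite sub1set in_pos_image.
  split; last by apply/forallP => a; apply/implyP; exact: dis.
  apply/andP; split.
    apply/subsetP => a aY; have := subsetP sub _ aY; rewrite atoms_core.
    case/orP=> // /existsP[l /andP[lN /eqP e]].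
    case: (neg_litE NX lN) => b lb _; move: (dis _ aY).
    by rewrite -e lb /= -lb lN.
  apply/forallP => r; apply/implyP => rQ; apply: (implyP (sat r)).
  by apply/core_programP; left.
split.
  by apply/subsetP => a aY; rewrite atoms_core (subsetP sub _ aY).
apply/forallP => r; apply/implyP => /core_programP[rQ|[l lN ->]].
  exact: (implyP (sat r)).
apply/orP; right; rewrite sub1set; case: (neg_litE NX lN) => a la _.
rewrite la in_pos_image /=; apply/negP => aY.
by have := implyP (dis a) aY; rewrite -la lN.
Qed.

(** On the reduct, the constraints amount to a condition closed under subsets, so they filter the
    minimal models without creating new ones. An assignment decides every atom of [P], so this
    condition on its true atoms says that it contains [N]. *)
Lemma answer_set_core P N M : N \subset neg_set (atoms P) ->
  answer_set (core_program P N) M = answer_set P M && (N \subset M).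
Proof.
move=> NX; rewrite !answer_setE atoms_core_sub // (reduct_core _ _ NX) -andbA.
case: (boolP (assignment _ _)) => //= /and3P[ML /forallP cons /forallP tot].
rewrite (minset_eq _ (fun Y => pos_model_core (reduct P (pos_part M)) Y NX)).
rewrite minset_downclosed; last first.
  move=> Y1 Y2 sub /forallP d; apply/forallP => a; apply/implyP => aY.
  exact: (implyP (d a) (subsetP sub _ aY)).
congr (_ && _); apply/forallP/subsetP => [d l lN|sub a].
  case: (neg_litE NX lN) => a la aX; rewrite la.
  case/orP: (implyP (tot a) aX) => // aM.
  by have := implyP (d a); rewrite inE -la lN => /(_ aM).
apply/implyP; rewrite inE => aM; apply/negP => /sub aN.
by have := implyP (cons _) aM; rewrite aN.
Qed.

Lemma core_program0 P : core_program P set0 = P.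
Proof. by rewrite /core_program imset0 setU0. Qed.

(** * Cautious consequences and cores *)

Lemma mem_cautious P a : (a \in cautious P) =
  (a \in atoms P) && [forall M, answer_set P M ==> (pos a \in M)].
Proof.
rewrite inE; congr (_ && _); apply/bigcapP/forallP => [h M|h M aM].
  by apply/implyP => /h; rewrite inE.
by rewrite inE; exact: (implyP (h M)).
Qed.

Lemma cautious_sub_answer P M : answer_set P M -> cautious P \subset pos_part M.
Proof.
move=> aM; apply/subsetP => a; rewrite mem_cautious => /andP[_ /forallP h].
by rewrite inE; exact: (implyP (h M)).
Qed.

(** An answer set in which [a] is false would survive the added constraint and contradict
    incoherence. *)
Lemma core1_cautious P a : is_core P [set neg a] -> a \in cautious P.
Proof.
case/andP; rewrite sub1set inE /= => aX inc; rewrite mem_cautious aX /=.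
apply/forallP => M; apply/implyP => aM; have := aM.
case/andP => /and3P[_ _ /forallP tot] _.
case/orP: (implyP (tot a) aX) => // naM.
case/negP: inc; apply/existsP; exists M.
by rewrite answer_set_core ?aM ?sub1set // in_neg_set.
Qed.

(** * Inconsistent records, programs without atoms, and existence of oracle answers *)

Lemma hatP (L : seq (literal At)) (l : literal At) :
  reflect (exists2 a, l = neg a & pos a \in L /\ neg a \in L) (l \in hat L).
Proof.
apply: (iffP imsetP) => [[a]|[a -> [h1 h2]]]; last by exists a; rewrite ?inE ?h1.
by rewrite inE => /andP[h1 h2] ->; exists a.
Qed.

Lemma hat_neq0 (L : seq (literal At)) :
  ~~ consistent (record_set L) -> hat L != set0.
Proof.
case/forallPn => -[a b]; rewrite negb_imply negbK !inE => /andP[h1 h2].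
apply/set0Pn; exists (neg a); apply/hatP; exists a => //.
by case: b h1 h2.
Qed.

Lemma record_set_enum M : record_set (enum M) = M.
Proof. by apply/setP => l; rewrite inE mem_enum. Qed.

Lemma no_atoms P : atoms P = set0 -> P = set0 \/ P = false_program At.
Proof.
move=> X0.
have rE r : r \in P -> r = (None, set0).
  case: r => h B rP; have nX a : a \notin atoms P by rewrite X0 inE.
  have -> : h = None.
    case: h rP => // a rP; case/negP: (nX a); apply/mem_atomsP.
    by exists (Some a, B) => //; left.
  congr (_, _); apply/setP => l; rewrite inE; apply/negP => lB.
  by case/negP: (nX l.1); apply/mem_atomsP; exists (h, B) => //; right; exists l.
case: (set_0Vmem P) => [->|[r rP]]; first by left.
right; apply/setP => s; rewrite inE; apply/idP/eqP => [/rE //|->].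
by rewrite -(rE r rP).
Qed.

Lemma answer_set_set0 : answer_set (set0 : program At) set0.
Proof.
have aE : atoms (set0 : program At) = set0.
  by apply/setP => a; rewrite !inE; apply/existsP => -[r]; rewrite inE.
rewrite answer_setE aE; apply/andP; split.
  apply/and3P; split; first exact: sub0set.
    by apply/forallP => l; rewrite inE.
  by apply/forallP => l; rewrite inE.
have -> : pos_part set0 = set0 :> {set At} by apply/setP => a; rewrite !inE.
apply/minsetP; split; last by move=> B _; rewrite subset0 => /eqP.
rewrite /pos_model sub0set; apply/forallP => r; apply/implyP => /imsetP[s].
by rewrite !inE.
Qed.

(** This keeps core states with an empty record from being stuck. In the incoherent case [N] must be
    nonempty, since the record has to contain a complementary pair. *)
Lemma oracle_exists P N : N \subset neg_set (atoms P) ->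
  (N != set0) || ~~ incoherent P -> exists L, oracle_answer P N L.
Proof.
move=> NX ok; case: (boolP (incoherent (core_program P N))) => inc; last first.
  have := inc; rewrite negbK => /existsP[M aM].
  exists (enum M); rewrite /oracle_answer (negbTE inc) record_set_enum aM andbT.
  rewrite /is_record enum_uniq record_set_enum /=.
  by move: aM => /andP[/and3P[]]; rewrite atoms_core_sub.
have N0 : N != set0.
  by case/orP: ok => //; apply: contraNneq => N0; rewrite N0 core_program0 in inc.
(* Listing [N] with all complements gives a record whose [hat] is [N] itself, the largest core
   allowed. *)
pose D : {set literal At} := [set l | (l \in N) || (compl l \in N)].
have mD l : (l \in enum D) = (l \in N) || (compl l \in N).
  by rewrite mem_enum inE.
have hE : hat (enum D) = N.
  apply/setP => l; apply/hatP/idP => [[a -> []]|lN].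
    rewrite !mD => /orP[/(neg_litE NX)[b []]//|//].
  case: (neg_litE NX lN) => a la aX; exists a => //.
  by rewrite !mD /compl /= -/(neg a) -la lN orbT.
exists (enum D); rewrite /oracle_answer inc hE subxx /is_core inc !andbT.
rewrite /is_record enum_uniq record_set_enum /=.
have sub : N \subset lits (atoms P).
  by apply/subsetP => l /(neg_litE NX)[a -> aX]; rewrite inE.
rewrite sub andbT; apply/andP; split.
  apply/subsetP => -[a b]; rewrite inE => /orP[/(subsetP sub)//|/(subsetP sub)].
  by rewrite !inE.
case/set0Pn: N0 => l lN; apply/forallPn; exists l.
rewrite negb_imply negbK !inE lN /= orbC.
by case: l lN => a b lN; rewrite /compl /= negbK lN.
Qed.

(** * The invariant and the decreasing rank *)

Definition state_inv P (S : state At) : Prop :=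
  match S with
  | CoreSt L O' U N =>
      [/\ U \subset cautious P, cautious P \subset O', N \subset neg_set O',
          O' \subset atoms P /\ N != set0 & L = [::] \/ oracle_answer P N L]
  | Cont O' U => U \subset cautious P /\ cautious P \subset O'
  | Pre N O' U => [/\ U \subset cautious P, cautious P \subset O',
                     N \subset neg_set O' & O' \subset atoms P]
  | Eval O' U => [/\ U \subset cautious P, cautious P \subset O'
                  & O' \subset atoms P]
  | Ok W => W = cautious P
  end.

(* Lexicographic in #|O|, then #|N|, then the position within the cycle
   Pre -> CoreSt [::] -> CoreSt L -> Pre; an Eval state counts as N = neg_set O. *)
Definition rank (S : state At) : nat :=
  let weight O' := #|O' : {set At}| * (3 * #|At| + 3) in
  match S with
  | CoreSt L O' U N => weight O' + 3 * #|N| + nilp L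
  | Cont O' U => weight O'
  | Pre N O' U => weight O' + 3 * #|N| + 2
  | Eval O' U => weight O' + 3 * #|O'| + 2
  | Ok O' => weight O'
  end.

Lemma neg_setS O O' : O \subset O' -> neg_set O \subset neg_set O'.
Proof. exact: imsetS. Qed.

(** An atom of [P] is what makes the initial [N] nonempty. *)
Lemma inv_init P : atoms P != set0 -> state_inv P (init P).
Proof.
move=> X0; split; rewrite ?sub0set ?subsetIl //; last by left.
by split=> //; rewrite imset_eq0.
Qed.

(** The record reveals which branch the oracle took: answer sets are consistent, while cores come
    with inconsistent records. *)
Lemma oracle_inconsistent P N L : N \subset neg_set (atoms P) ->
  oracle_answer P N L -> ~~ consistent (record_set L) ->
  is_core P (hat L) /\ hat L :&: N = hat L.
Proof.
move=> NX /andP[_]; case: ifP => _.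
  by case/and3P=> _ c h _; split=> //; apply/setIidPl.
by rewrite answer_set_core // => /andP[/andP[/and3P[_ -> _]]].
Qed.

Lemma oracle_consistent P N L : N \subset neg_set (atoms P) ->
  oracle_answer P N L -> consistent (record_set L) ->
  answer_set P (record_set L) /\ N \subset record_set L.
Proof.
move=> NX /andP[_]; case: ifP => _; first by case/and3P=> /negP.
by rewrite answer_set_core // => /andP[].
Qed.

Lemma consistent_nil : consistent (record_set ([::] : seq (literal At))).
Proof. by apply/forallP => l; rewrite inE. Qed.

(** The empty record is consistent, so as an answer it would be an answer set containing the
    nonempty [N]. This excludes a [CoreOracle] step from a state to itself. *)
Lemma nonempty_oracle P O N L : O \subset atoms P -> N \subset neg_set O ->
  N != set0 -> oracle_answer P N L -> L <> [::].
Proof.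
move=> OX NO /set0Pn[l lN] oL L0; have NX := subset_trans NO (neg_setS OX).
rewrite {}L0 in oL.
have [_ /subsetP/(_ _ lN)] := oracle_consistent NX oL consistent_nil.
by rewrite inE.
Qed.

(** Losing one element of [N] frees 3, enough to restart the cycle at its highest position, 2. *)
Lemma rank_drop w m n k : m < n -> w + 3 * m + 2 < w + 3 * n + k.
Proof. lia. Qed.

(** Losing one atom of [O] frees [3 * t + 3], which exceeds the new remainder [3 * o' + 2] because
    [o' < o <= t]. *)
Lemma weight_drop o o' t m k : o' < o -> o <= t ->
  o' * (3 * t + 3) + 3 * o' + 2 < o * (3 * t + 3) + m + k.
Proof.
move=> lt le.
have: o'.+1 * (3 * t + 3) <= o * (3 * t + 3) by rewrite leq_mul2r lt orbT.
by rewrite mulSn; lia.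
Qed.

(** Both claims go together because the strict decrease relies on the invariant: [N] is nonempty, it
    negates atoms of [O], and a nonempty record is an oracle answer. *)
Lemma step_inv P S S' : state_inv P S -> step P S S' -> state_inv P S' /\ rank S' < rank S.
Proof.
move=> iS st; case: st iS => /=.
- move=> L' O U N oL [UC CO NO [OX N0] _]; split; first by split=> //; right.
  by case: L' oL => [/(nonempty_oracle OX NO N0)//|l L _] /=; lia.
- move=> L O U N a inc hN [UC CO NO [OX N0] oL].
  have NX := subset_trans NO (neg_setS OX).
  case: oL inc hN => [-> /negP[]|oL inc hN]; first exact: consistent_nil.
  have [co hE] := oracle_inconsistent NX oL inc.
  split.
    split=> //; last by apply: subset_trans NO; apply: subsetDl.
    (* As [hat L] lies inside [N], the whole core is the singleton of [neg a]. *)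
    rewrite subUset sub1set UC andbT; apply: core1_cautious.
    by rewrite -hN hE.
  have aN : neg a \in N.
    by have /setIP[] : neg a \in hat L :&: N by rewrite hN set11.
  by apply: rank_drop; rewrite (cardsD1 (neg a) N) aN.
- move=> L O U N inc hN [UC CO NO [OX N0] oL]; split.
    by split=> //; apply: subset_trans NO; apply: subsetDl.
  apply: rank_drop; rewrite -(cardsID (hat L) N) setIC.
  by rewrite -[X in X < _]add0n ltn_add2r ltnW.
- move=> L O U N cons Ln [UC CO NO [OX N0] [//|oL]].
  have NX := subset_trans NO (neg_setS OX).
  have [aL NL] := oracle_consistent NX oL cons.
  split.
    split=> //; first by rewrite subsetI CO cautious_sub_answer.
    by apply: subset_trans OX; apply: subsetIl.
  (* The answer set contains [N], and any element of [N] negates an atom of [O], which therefore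
     leaves [O]. *)
  have lt : #|O :&: pos_part (record_set L)| < #|O|.
    apply: proper_card; apply/properP; split; first exact: subsetIl.
    case/set0Pn: N0 => l lN; case: (neg_litE NO lN) => a la aO; exists a => //.
    rewrite inE aO /= inE; apply/negP => aL'.
    have := implyP (forallP cons (pos a)) aL'.
    by rewrite (_ : compl _ = l) ?(subsetP NL) // la.
  by apply: weight_drop => //; exact: max_card.
- by move=> N O U N0 [UC CO NO OX]; split=> //; lia.
- move=> N O U N0 [UC CO NO OX]; split; last by lia.
  by split=> //; [split=> //; apply/eqP | left].
- move=> O U OU [UC CO OX]; split; last first.
  by rewrite addn1 addn2 ltnS ltnS leq_add2l leq_mul2l leq_imset_card.
  split=> //; last by left.
  (* An empty [O] would force [U] to be empty too, through the cautious consequences between them,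
     against [O <> U]. *)
  split=> //; rewrite imset_eq0; apply/eqP => O0; apply: OU; rewrite O0.
  by apply/esym/eqP; rewrite -subset0 -O0 (subset_trans UC).
- move=> O U OU [UC CO OX]; split; last by lia.
  by apply/eqP; rewrite eqEsubset CO OU UC.
Qed.

(** * Reachable states, acyclicity and finiteness *)

Lemma reachable_inv P S : atoms P != set0 -> reachable P S -> state_inv P S.
Proof.
move=> X0 /(Operators_Properties.clos_rt_rtn1 _ _ _ _); elim=> [|S1 S2 [_ _ st] _ IH].
  exact: inv_init.
by case: (step_inv IH st).
Qed.

Lemma path_inv P S S' : clos_trans _ (edge P) S S' -> state_inv P S ->
  state_inv P S' /\ rank S' < rank S.
Proof.
elim=> [S1 S2 [_ _ st] iS|S1 S2 S3 _ IH1 _ IH2 iS]; first exact: step_inv st.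
have [i2 r2] := IH1 iS; have [i3 r3] := IH2 i2; split=> //.
exact: ltn_trans r2.
Qed.

Lemma acyclic_graph P : atoms P != set0 -> acyclic P.
Proof.
move=> X0 S /(reachable_inv X0) iS path.
by have [_] := path_inv path iS; rewrite ltnn.
Qed.

(** Records have no repetitions, so their length is bounded by the number of literals. Every vertex
    is thus the image of a tuple in a finite type, whose first component selects the constructor. *)
Lemma finite_vertices P : finite_graph P.
Proof.
pose T := ('I_5 * #|{: literal At}|.-bseq (literal At)
           * {set At} * {set At} * {set literal At})%type.
pose f (t : T) : state At :=
  let: (k, L, O', U, N) := t in
  match val k with
  | 0 => CoreSt L O' U N
  | 1 => Cont O' U
  | 2 => Pre N O' U
  | 3 => Eval O' U
  | _ => Ok O'
  end.
have fin t : List.In (f t) [seq f t | t <- enum {: T}].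
  have: t \in enum {: T} by rewrite mem_enum.
  elim: (enum _) => //= u s IH; rewrite inE.
  by case/orP=> [/eqP->|/IH]; [left|right].
exists [seq f t | t <- enum {: T}] => S.
case: S => [L O U N|O U|N O U|O U|W] /=.
- case=> /andP[uL _] _ _ _.
  have sL : size L <= #|{: literal At}| by rewrite -(card_uniqP uL) max_card.
  by have := fin (inord 0, Bseq sL, O, U, N); rewrite /= inordK.
- by have := fin (inord 1, [bseq], O, U, set0); rewrite /= inordK.
- by have := fin (inord 2, [bseq], O, U, N); rewrite /= inordK.
- by have := fin (inord 3, [bseq], O, U, set0); rewrite /= inordK.
- by have := fin (inord 4, [bseq], W, set0, set0); rewrite /= inordK.
Qed.

(** The only record is the empty one. It is consistent, so neither failure rule applies, and
    [Find_pre] asks for a nonempty record. *)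
Lemma reachable_no_atoms P S : atoms P = set0 -> reachable P S ->
  exists O U N, S = CoreSt [::] O U N.
Proof.
move=> X0 rS.
suff: (if S is CoreSt [::] _ _ _ then True else False) : Prop.
  by case: S {rS} => // -[|//] O U N _; exists O, U, N.
move: rS => /(Operators_Properties.clos_rt_rtn1 _ _ _ _).
elim=> [//|S1 S2 [_ v st] _]; case: st v => //=.
- move=> [//|l L] O U N _ [/andP[_ /subsetP sub] _ _ _] _.
  by have := sub l; rewrite in_set mem_head in_set X0 inE => /(_ isT).
- by move=> [|//] O U N a; rewrite consistent_nil.
- by move=> [|//] O U N; rewrite consistent_nil.
- by move=> [|//] O U N _.
Qed.

(** * States with outgoing edges *)

Lemma oracle_outgoing P O U N : vertex P (CoreSt [::] O U N) ->
  N \subset neg_set (atoms P) -> (N != set0) || ~~ incoherent P ->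
  exists S, edge P (CoreSt [::] O U N) S.
Proof.
move=> v NX ok; have [L oL] := oracle_exists NX ok; exists (CoreSt L O U N).
by split=> //; [case: v => _ *; split=> //; case/andP: oL | constructor].
Qed.

Lemma inv_outgoing P S : vertex P S -> state_inv P S ->
  [\/ exists O U, S = Cont O U, exists O, S = Ok O | exists S', edge P S S'].
Proof.
case: S => [L O U N|O U|N O U|O U|W] v /=; last first.
- by constructor 2; exists W.
- move=> _; constructor 3; have [OX UX] := v; case: (O =P U) => OU.
    by exists (Ok O); split=> //; constructor.
  exists (CoreSt [::] O U (neg_set O)); split=> //; last by constructor.
  split=> //; first by apply/andP; split=> //; apply/subsetP => l; rewrite inE.
  by apply/subsetP => l /imsetP[a aO ->]; rewrite in_set (subsetP OX).
- move=> _; constructor 3; have [NX OX UX] := v; case: (N =P set0) => N0.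
    by exists (Cont O U); split=> //; constructor.
  exists (CoreSt [::] O U N); split=> //; last by constructor.
  by split=> //; apply/andP; split=> //; apply/subsetP => l; rewrite inE.
- by constructor 1; exists O, U.
case=> _ _ NO [_ N0] oL; constructor 3; have [LX OX UX NL] := v.
have NX := subset_trans NO (neg_setS OX).
case: (L =P [::]) => [L0|Ln].
  by rewrite {}L0 in v *; apply: oracle_outgoing; rewrite ?N0.
case: oL => // oL; case: (boolP (consistent (record_set L))) => [cons|inc].
  exists (Eval (O :&: pos_part (record_set L)) U); split=> //; last by constructor.
  by split=> //; apply: subset_trans OX; apply: subsetIl.
have [_ hE] := oracle_inconsistent NX oL inc.
have hn := hat_neq0 inc.
(* The intersection is [hat L], nonempty since [L] is inconsistent; one element calls for
   [Fail1_pre], several for [Fail2_pre]. *)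
case: (ltnP 1 #|hat L :&: N|) => [h1|]; last first.
  rewrite leq_eqVlt ltnS leqn0 hE cards_eq0 (negbTE hn) orbF => /cards1P[l hl].
  have /hatP[a la [aL _]] : l \in hat L by rewrite hl set11.
  exists (Pre (N :\ neg a) O (a |: U)); split=> //; last first.
    by apply: (Fail1_pre _ _ _ inc); rewrite hE hl la.
  split=> //; first exact: subset_trans (subsetDl _ _) NL.
  rewrite subUset sub1set UX andbT.
  case/andP: LX => _ /subsetP/(_ (pos a)).
  by rewrite in_set in_set; apply.
exists (Pre (N :\: hat L) O U); split=> //; last by constructor.
by split=> //; exact: subset_trans (subsetDl _ _) NL.
Qed.

Lemma reachable_vertex P S : reachable P S -> vertex P S.
Proof.
move/(Operators_Properties.clos_rt_rtn1 _ _ _ _); elim=> [|S1 S2 [_ //]].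
split; rewrite ?sub0set //.
  by apply/andP; split=> //; apply/subsetP => l; rewrite inE.
by apply/subsetP => l /imsetP[a aO ->]; rewrite in_set.
Qed.

End CoreBasedSolver.

Theorem theorem3 (At : finType) (Pi : program At) :
  (Pi <> false_program At ->
   forall S : state At, reachable Pi S -> no_outgoing Pi S ->
     (exists O U : {set At}, S = Cont O U) \/ (exists O : {set At}, S = Ok O))
  /\
  (forall O : {set At}, reachable Pi (Ok O) -> solves_cautious Pi)
  /\
  (forall O U : {set At}, reachable Pi (Cont O U) ->
     U \subset cautious Pi /\ cautious Pi \subset O).
Proof.
(* Without atoms the invariant fails at the initial state, whose [N] is then empty. *)
have [X0|X0] := eqVneq (atoms Pi) set0; last first.
  split=> [_ S rS out|].
    case: (inv_outgoing (reachable_vertex rS) (reachable_inv X0 rS)).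
    - by left.
    - by right.
    - by case=> S' /out.
  split=> [O rO|O U rC]; last exact: (reachable_inv X0 rC).
  split; [exact: finite_vertices | exact: acyclic_graph |].
  (* The invariant identifies the given [O] with the cautious consequences, so the reachable [Ok O]
     is the required terminal state. *)
  by split=> [|W /(reachable_inv X0) /= -> //]; rewrite -(reachable_inv X0 rO).
split; last first.
  (* Without atoms no [Ok] or [Cont] state is reachable, so (ii) and (iii) hold vacuously. *)
  by split=> [O|O U] /(reachable_no_atoms X0)[? [? [?]]].
move=> nF S rS out; have := reachable_vertex rS.
have [O [U [N eS]]] := reachable_no_atoms X0 rS; rewrite {}eS in out *.
move=> v; have [_ _ _ NL] := v.
have N0 : N = set0.
  apply/setP => l; rewrite inE; apply/negP => /(subsetP NL).
  by rewrite in_set X0 inE.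
(* Only the empty program remains; its answer set is empty, so the oracle can answer with the empty
   record and the state has an outgoing edge. *)
case: (no_atoms X0) => // P0.
have [] := oracle_outgoing v; last by move=> S' /out.
  by rewrite N0 sub0set.
rewrite negbK P0; apply/orP; right; apply/existsP; exists set0.
exact: answer_set_set0.
Qed.
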